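(* Let $c\ge 3$, $b\ge 1$ be integers. The spectrum of the clique $2$-down Laplacian $\delta_{1}\delta_{1}^T$ of $G_{c,b}$ consists of the eigenvalue $0$ with multiplicity $\binom{c}{3}+(b-1)\binom{c-1}{2}$, the eigenvalue $c$ with multiplicity $(b-1)(c-1)$, and the eigenvalue $b+c$ with multiplicity $\binom{c}{2}$ (eigenvalues listed with multiplicity $0$ being omitted).
   Context: $G_{c,b}$ is the graph on vertex set $\{1,\dots,b+c\}$ (with the natural order) with edges $\{i,j\}$ for $1\le i<j\le c$ and $\{i,j\}$ for $c+1\le i\le c+b$, $1\le j\le c$ (i.e. $K_c$ joined to $b$ independent vertices). $\mathcal T_{c,b}$ is the set of all triangles ($3$-cliques) of $G_{c,b}$. For $T=\{a,b',c'\}$ with $a<b'<c'$ and an edge $e$, $[T:e]$ is $1$ if $e=\{a,b'\}$ or $\{b',c'\}$, $-1$ if $e=\{a,c'\}$, $0$ if $e\not\subset T$; $\delta_1$ is the $\mathcal T_{c,b}\times E(G_{c,b})$ matrix with entries $[T:e]$, and the clique $2$-down Laplacian is $\delta_1\delta_1^T$. *)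

(* Defs.v *)
From mathcomp Require Import all_boot all_order all_algebra.

Set Implicit Arguments.
Unset Strict Implicit.
Unset Printing Implicit Defensive.

Import GRing.Theory.
Local Open Scope ring_scope.

(* A graph on {1, ..., n} is given by its set of edges, each edge being a
   two-element set of vertices; vertex k is represented by k - 1 : 'I_n. *)

Definition triangles n (E : {set {set 'I_n}}) : {set {set 'I_n}} :=
  [set T : {set 'I_n} | (#|T| == 3%N) &&
    [forall i in T, forall j in T, (i != j) ==> ([set i; j] \in E)]].

Definition incidence (R : pzRingType) n (T e : {set 'I_n}) : R :=
  if [exists x : 'I_n, exists y : 'I_n, exists z : 'I_n,
       [&& (x < y)%N, (y < z)%N, T == [set x; y; z]
         & (e == [set x; y]) || (e == [set y; z])]] then 1
  else if [exists x : 'I_n, exists y : 'I_n, exists z : 'I_n,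
       [&& (x < y)%N, (y < z)%N, T == [set x; y; z]
         & e == [set x; z]]] then -1
  else 0.

Definition coboundary1 (R : pzRingType) n (E : {set {set 'I_n}}) :
    'M[R]_(#|triangles E|, #|E|) :=
  \matrix_(i, j) incidence R (enum_val i) (enum_val j).

Definition down_laplacian2 (R : pzRingType) n (E : {set {set 'I_n}}) :
    'M[R]_#|triangles E| :=
  coboundary1 R E *m (coboundary1 R E)^T.

Definition Gedges (c b : nat) : {set {set 'I_(b + c)}} :=
  [set e : {set 'I_(b + c)} |
    [exists i : 'I_(b + c), exists j : 'I_(b + c),
      (e == [set i; j]) && (((i < j)%N && (j < c)%N)
                            || ((c <= i)%N && (j < c)%N))]].

(* s lists the eigenvalues of A with multiplicity. Algebraic and geometric
   multiplicities agree for real symmetric matrices, so both are required. *)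
Definition has_spectrum (F : fieldType) n (A : 'M[F]_n) (s : seq F) : Prop :=
  char_poly A = \prod_(a <- s) ('X - a%:P)
  /\ forall x : F, \rank (eigenspace A x) = count_mem x s.

(* Main.v *)
Require Import Defs.
From mathcomp Require Import all_boot all_order all_algebra.
From mathcomp Require Import zify ring.

(** Let C be the clique of a complete split graph on n vertices, c = #|C|, let L
    be the 2-down Laplacian, u a row vector on triangles, and let f be the
    antisymmetric function on ordered edges given by u *m delta_1.  Summing f
    over the edges at any vertex gives 0, whence passing from u to u *m L
    multiplies f by n inside C and sends f x y to c f x y + sum_(q notin C) f x q
    on an edge from x in C to y outside C.  This yields the annihilating
    polynomial X (X - c) (X - n), so L is diagonalizable.  It also bounds the
    eigenspaces from above: an eigenvector for n is determined by f on the pairs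
    in C, and one for c has f = 0 on C and a matrix with zero row and column sums
    outside, hence is determined by (c - 1) (n - c - 1) values.  Since
    the trace of L is three times the number of triangles, both bounds are
    attained. *)

Set Implicit Arguments.
Unset Strict Implicit.
Unset Printing Implicit Defensive.

Import GRing.Theory Num.Theory.
Local Open Scope ring_scope.

(** * Spectra of diagonalizable matrices *)

Lemma rank_diag_mx (F : fieldType) (n : nat) (d : 'rV[F]_n) :
  \rank (diag_mx d) = (\sum_i (d 0%R i != 0%R))%N.
Proof.
elim: n d => [|n IHn] d; first by rewrite thinmx0 mxrank0 big_ord0.
pose d1 : 'rV_(1 + n) := d.
have -> : diag_mx d = block_mx (lsubmx d1) 0 0 (diag_mx (rsubmx d1)).
  rewrite (_ : lsubmx d1 = diag_mx (lsubmx d1)) -?diag_mx_row ?hsubmxK //.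
  by apply/rowP => i; rewrite !mxE !ord1.
transitivity (\rank (lsubmx d1) + \rank (diag_mx (rsubmx d1)))%N.
  exact: (rank_diag_block_mx (lsubmx d1) (diag_mx (rsubmx d1))).
rewrite IHn.
rewrite rank_rV big_ord_recl; congr (_ + _)%N; last first.
  apply: eq_bigr => i _; rewrite mxE; congr (d _ _ != 0 : nat).
  exact: val_inj.
rewrite -(inj_eq (@trmx_inj _ _ _)) trmx0; congr (~~ _ : nat).
apply/eqP/eqP => [/matrixP/(_ 0 0)|d0].
  by rewrite !mxE => <-; congr (d _ _); apply: val_inj.
apply/matrixP => i j; rewrite !mxE !ord1 -[RHS]d0.
by congr (d _ _); apply: val_inj.
Qed.

(** Similarity preserves both data: the characteristic polynomials agree after cancelling [\det P],
    and the eigenspace at [x] has as dimension the number of zero entries of [d - const_mx x]. *)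
Lemma diagonal_has_spectrum (F : fieldType) (n : nat) (P A : 'M[F]_n)
    (d : 'rV[F]_n) : P \in unitmx -> P *m A = diag_mx d *m P ->
  has_spectrum A [seq d 0 i | i <- enum 'I_n].
Proof.
move=> uP PA; split=> [|x].
  rewrite big_map big_enum /=.
  have /mulfI : (\det (map_mx polyC P)) != 0.
    by rewrite det_map_mx polyC_eq0 -unitfE -unitmxE.
  apply; rewrite -det_mulmx /char_poly_mx mulmxBr -map_mxM PA map_mxM.
  rewrite scalar_mxC -mulmxBl det_mulmx mulrC; congr (_ * _).
  have := char_poly_trig (diag_mx_is_trig d); rewrite /char_poly /char_poly_mx => ->.
  by apply: eq_bigr => i _; rewrite mxE eqxx mulr1n.
rewrite /eigenspace mxrank_ker.
have -> : \rank (A - x%:M) = \rank (P *m (A - x%:M)).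
  by rewrite eqmxMfull // row_full_unit.
rewrite mulmxBr PA scalar_mxC -mulmxBl mxrankMfree ?row_free_unit //.
rewrite -diag_const_mx -raddfB /= rank_diag_mx count_map.
have nE : n = (\sum_(i < n) (d 0%R i == x) + \sum_(i < n) (d 0%R i != x))%N.
  rewrite -big_split -[LHS]card_ord -sum1_card.
  by apply: eq_bigr => i _ /=; case: eqP.
have -> : (\sum_i ((d - const_mx x)%R 0%R i != 0%R) =
           \sum_(i < n) (d 0%R i != x))%N.
  by apply: eq_bigr => i _; rewrite !mxE subr_eq0.
by rewrite [X in (X - _)%N]nE addnK -sum1_count big_enum_cond /= -big_mkcond.
Qed.

(** The minimal polynomial divides a product of distinct linear factors, so [A] is diagonalizable.
    Trace and size are recorded because they later fix the multiplicities. *)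
Lemma annihilated_has_spectrum (F : fieldType) (n : nat) (A : 'M[F]_n)
    (rs : seq F) : uniq rs -> \prod_(x <- rs) (A - x%:M) = 0 ->
  exists s : seq F, [/\ has_spectrum A s, \tr A = \sum_(a <- s) a, size s = n
                      & {subset s <= rs}].
Proof.
move=> rs_uniq A0.
have [P uP [d PA]] : exists2 P : 'M[F]_n, P \in unitmx &
    exists d, P *m A = diag_mx d *m P.
  case: n A A0 => [|n] A A0.
    by exists 1%:M; [exact: unitmx1 | exists 0; rewrite !thinmx0].
  have /diagonalizableP [P uP] : exists2 rs, uniq rs &
      mxminpoly A %| \prod_(x <- rs) ('X - x%:P).
    exists rs => //; rewrite mxminpoly_min // rmorph_prod -[RHS]A0.
    by apply: eq_bigr => x _; rewrite rmorphB /= horner_mx_X horner_mx_C.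
  move/diagonalizable_forPex => [d /(simmxP uP) PA].
  by exists P => //; exists d.
exists [seq d 0 i | i <- enum 'I_n]; split.
- exact: diagonal_has_spectrum PA.
- rewrite -[A](mulKmx uP) PA mxtrace_mulC mulmxK // mxtrace_diag big_map.
  by rewrite big_enum.
- by rewrite size_map size_enum_ord.
move=> _ /mapP[i _ ->].
(* Conjugation by [P] makes the product diagonal, with entries the products of [d 0 j - x]. Since it
   vanishes for [rs], every entry of [d] is a root. *)
have PAk (s : seq F) : P *m (\prod_(x <- s) (A - x%:M)) =
    diag_mx (\row_j \prod_(x <- s) (d 0 j - x)) *m P.
  elim: s => [|x s IHs].
    rewrite big_nil mulmx1 (_ : \row_j _ = const_mx 1) ?diag_const_mx ?mul1mx //.
    by apply/rowP => j; rewrite !mxE big_nil.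
  rewrite big_cons mulmxA mulmxBr PA scalar_mxC -mulmxBl -mulmxA IHs mulmxA.
  rewrite -diag_const_mx -raddfB /= mulmx_diag; congr (diag_mx _ *m _).
  by apply/rowP => j; rewrite !mxE big_cons.
have := PAk rs; rewrite A0 mulmx0 => /esym/(congr1 (mulmx^~ (invmx P))).
rewrite mulmxK // mul0mx => /matrixP/(_ i i); rewrite !mxE eqxx mulr1n.
move/eqP; rewrite prodf_seq_eq0 => /hasP[x xrs /=].
by rewrite subr_eq0 => /eqP ->.
Qed.

Lemma has_spectrum_perm (F : fieldType) (n : nat) (A : 'M[F]_n) (s t : seq F) :
  perm_eq s t -> has_spectrum A s -> has_spectrum A t.
Proof.
move=> st [sA rA]; split=> [|x]; first by rewrite sA; exact: perm_big.
by rewrite rA; move/seq.permP: st => ->.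
Qed.

(** The row space of [V] meets the kernel of [K] trivially, so [K] embeds it in a space of dimension
    [p]. *)
Lemma rank_le_injective (F : fieldType) (m n p : nat) (V : 'M[F]_(m, n))
    (K : 'M[F]_(n, p)) :
    (forall u : 'rV_n, (u <= V)%MS -> u *m K = 0 -> u = 0) ->
  (\rank V <= p)%N.
Proof.
move=> inj; suff /mxrank_injP <- : (V :&: kermx K)%MS == 0.
  exact: rank_leq_col.
apply/rowV0P => u; rewrite sub_capmx => /andP[uV /sub_kermxP]; exact: inj.
Qed.

(** * Incidence of edges in sorted triangles *)

Lemma set3C (T : finType) (x y z : T) : [set x; y; z] = [set y; x; z].
Proof. by apply/setP => t; rewrite !inE; do !case: eqP. Qed.

Lemma set3CA (T : finType) (x y z : T) : [set x; y; z] = [set y; z; x].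
Proof. by apply/setP => t; rewrite !inE; do !case: eqP. Qed.

Lemma cards3 (T : finType) (x y z : T) :
  (#|[set x; y; z]| == 3%N) = [&& x != y, y != z & x != z].
Proof.
rewrite setUC cardsU1 cards2 !inE (eq_sym z x) (eq_sym z y).
by case: (x == y); case: (x == z); case: (y == z).
Qed.

Lemma cards3_sorted (n : nat) (T : {set 'I_n}) : #|T| = 3%N ->
  exists x y z : 'I_n, [/\ (x < y)%N, (y < z)%N & T = [set x; y; z]].
Proof.
move=> T3; have /set0Pn[x xT] : T != set0 by rewrite -card_gt0 T3.
have /cards2P[y [z [yz Tx]]] : #|T :\ x| == 2.
  by move: T3; rewrite (cardsD1 x) xT; lia.
have TE : T = [set x; y; z] by rewrite -(setD1K xT) Tx setUA.
have : #|[set x; y; z]| == 3 by rewrite -TE T3.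
rewrite cards3 {xT yz Tx T3} => /and3P[xy yz xz]; rewrite {T}TE.
case: (ltngtP x y) xy => [xy|xy|/val_inj->]; rewrite ?eqxx //.
- case: (ltngtP y z) yz => [yz|zy|/val_inj->]; rewrite ?eqxx // => _ _.
    by exists x, y, z.
  case: (ltngtP x z) xz => [xz|zx|/val_inj->]; rewrite ?eqxx // => _.
    by exists x, z, y; rewrite set3C set3CA.
  by exists z, x, y; rewrite -set3CA.
case: (ltngtP x z) xz => [xz|zx|/val_inj->]; rewrite ?eqxx // => _ _.
  by exists y, x, z; rewrite set3C.
case: (ltngtP y z) yz => [yz|zy|/val_inj->]; rewrite ?eqxx // => _.
  by exists y, z, x; rewrite set3CA.
by exists z, y, x; rewrite set3C -set3CA.
Qed.

Lemma set2_sorted_inj (n : nat) (x y a b : 'I_n) : (x < y)%N -> (a < b)%N ->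
  ([set x; y] == [set a; b]) = (x == a) && (y == b).
Proof.
move=> xy ab; apply/eqP/andP => [/setP E|[/eqP-> /eqP->]] //.
move: (E x) (E y) (E a) (E b); rewrite !inE !eqxx ?orbT /= -!val_eqE /=.
by move=> *; split; lia.
Qed.

Lemma set3_sorted_inj (n : nat) (x y z a b c : 'I_n) :
    (x < y)%N -> (y < z)%N -> (a < b)%N -> (b < c)%N ->
  [set x; y; z] = [set a; b; c] -> [/\ x = a, y = b & z = c].
Proof.
move=> xy yz ab bc /setP E.
move: (E x) (E y) (E z) (E a) (E b) (E c).
rewrite !inE !eqxx ?orbT /= -!val_eqE /=.
by move=> *; split; apply: val_inj => /=; lia.
Qed.

(** A set of three vertices has only one increasing enumeration, so the existentials in [incidence]
    have no other witnesses; the nested conditional becomes a sum because the three edges are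
    distinct. *)
Lemma incidence_sorted (R : pzRingType) (n : nat) (x y z : 'I_n)
    (e : {set 'I_n}) : (x < y)%N -> (y < z)%N ->
  incidence R [set x; y; z] e =
    (e == [set x; y])%:R + (e == [set y; z])%:R - (e == [set x; z])%:R.
Proof.
move=> xy yz; have xz := ltn_trans xy yz; rewrite /incidence.
have -> : [exists x0 : 'I_n, exists y0 : 'I_n, exists z0 : 'I_n,
    [&& (x0 < y0)%N, (y0 < z0)%N, [set x; y; z] == [set x0; y0; z0]
      & (e == [set x0; y0]) || (e == [set y0; z0])]] =
    (e == [set x; y]) || (e == [set y; z]).
  apply/existsP/idP => [[a /existsP[b /existsP[c]]]|E].
    by case/and4P => ab bc /eqP /(set3_sorted_inj xy yz ab bc) [<- <- <-].
  exists x; apply/existsP; exists y; apply/existsP; exists z.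
  by rewrite xy yz eqxx E.
have -> : [exists x0 : 'I_n, exists y0 : 'I_n, exists z0 : 'I_n,
    [&& (x0 < y0)%N, (y0 < z0)%N, [set x; y; z] == [set x0; y0; z0]
      & e == [set x0; z0]]] = (e == [set x; z]).
  apply/existsP/idP => [[a /existsP[b /existsP[c]]]|E].
    by case/and4P => ab bc /eqP /(set3_sorted_inj xy yz ab bc) [<- _ <-].
  exists x; apply/existsP; exists y; apply/existsP; exists z.
  by rewrite xy yz eqxx E.
have yx_neq : y == x = false by rewrite -val_eqE /= gtn_eqF.
have yz_neq : y == z = false by rewrite -val_eqE /= ltn_eqF.
have xy_neq : x == y = false by rewrite eq_sym.
case: eqP => [->|_] /=.
  by rewrite !set2_sorted_inj // xy_neq yz_neq eqxx /= !mulr0n addr0 subr0.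
case: eqP => [->|_] /=.
  by rewrite !set2_sorted_inj // yx_neq eqxx /= !mulr0n add0r subr0.
by case: eqP => _; rewrite ?mulr0n ?addr0 ?subr0 ?sub0r.
Qed.

(** Multiplication by this sign turns a function on unordered edges into an antisymmetric function
    on ordered pairs, zero on the diagonal. *)
Definition osign (R : pzRingType) (n : nat) (x y : 'I_n) : R :=
  (x < y)%N%:R - (y < x)%N%:R.

Lemma osignC (R : pzRingType) (n : nat) (x y : 'I_n) :
  osign R y x = - osign R x y.
Proof. by rewrite /osign opprB. Qed.

(** The elementary antisymmetric function carried by the oriented edge from [a] to [b]. *)
Definition oedge (R : pzRingType) (n : nat) (a b x y : 'I_n) : R :=
  ((x == a) && (y == b))%:R - ((x == b) && (y == a))%:R.

Lemma osign_edge (R : pzRingType) (n : nat) (a b x y : 'I_n) : (a < b)%N ->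
  osign R x y * ([set x; y] == [set a; b])%:R = oedge R a b x y.
Proof.
move=> ab; rewrite /osign /oedge.
case: (ltngtP x y) => [xy|yx|/val_inj->].
- rewrite set2_sorted_inj // subr0 mul1r.
  by case: (boolP ((x == b) && _)) => [|_]; rewrite -?val_eqE ?subr0 //=; lia.
- rewrite setUC set2_sorted_inj // sub0r mulN1r.
  case: (boolP ((x == a) && _)) => [|_]; first by rewrite -?val_eqE /=; lia.
  by rewrite sub0r andbC.
- by rewrite subrr mul0r andbC subrr.
Qed.

(** The coefficient -1 of the long edge is absorbed by reversing it, so the boundary of a triangle
    becomes the oriented cycle from [a] to [b] to [c] and back. *)
Lemma osign_incidence (R : pzRingType) (n : nat) (a b c x y : 'I_n) :
    (a < b)%N -> (b < c)%N ->
  osign R x y * incidence R [set a; b; c] [set x; y] =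
    oedge R a b x y + oedge R b c x y + oedge R c a x y.
Proof.
move=> ab bc; have ac := ltn_trans ab bc.
rewrite incidence_sorted // mulrBr mulrDr !osign_edge //.
by congr (_ + _); rewrite /oedge opprB.
Qed.

(** The divergence of an oriented edge; around an oriented triangle these contributions telescope to
    0. *)
Lemma sum_oedge (R : pzRingType) (n : nat) (a b x : 'I_n) :
  \sum_y oedge R a b x y = (x == a)%:R - (x == b)%:R.
Proof.
have S (p q : 'I_n) : \sum_y ((x == p) && (y == q))%:R = (x == p)%:R :> R.
  rewrite (bigD1 q) //= eqxx andbT big1 ?addr0 // => y /negPf->.
  by rewrite andbF.
by rewrite sumrB !S.
Qed.

(** * Antisymmetric edge functions *)

Lemma ord_lt_eqF (n : nat) (x y : 'I_n) :
  (x < y)%N -> (x == y = false) * (y == x = false).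
Proof.
by move=> xy; split; rewrite -val_eqE /=; [exact: ltn_eqF | exact: gtn_eqF].
Qed.

Lemma set3_triangle (n : nat) (E : {set {set 'I_n}}) (x y z : 'I_n) :
  ([set x; y; z] \in triangles E) =
    [&& x != y, y != z, x != z, [set x; y] \in E, [set y; z] \in E
      & [set x; z] \in E].
Proof.
rewrite inE cards3; case: (boolP (x != y)) => //= xy.
case: (boolP (y != z)) => //= yz; case: (boolP (x != z)) => //= xz.
apply/forall_inP/and3P => [H|[Exy Eyz Exz] i].
  have P i j : i \in [set x; y; z] -> j \in [set x; y; z] -> i != j ->
      [set i; j] \in E by move=> /H/forall_inP/(_ _)/[apply]/implyP.
  by split; apply: P; rewrite // !inE eqxx ?orbT.
rewrite !inE => iT; apply/forall_inP => j; rewrite !inE => jT.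
apply/implyP; case/orP: iT => [/orP[]|] /eqP->; case/orP: jT => [/orP[]|] /eqP->;
  by rewrite ?eqxx // setUC.
Qed.

Lemma triangle_sorted (n : nat) (E : {set {set 'I_n}}) (T : {set 'I_n}) :
  T \in triangles E -> exists x y z : 'I_n,
    [/\ (x < y)%N, (y < z)%N & T = [set x; y; z]].
Proof. by rewrite inE => /andP[/eqP/cards3_sorted]. Qed.

(* The row vector [u *m coboundary1 R E], extended antisymmetrically to ordered
   pairs of vertices. *)
Definition edgeval (R : comNzRingType) (n : nat) (E : {set {set 'I_n}})
    (u : 'rV[R]_#|triangles E|) : 'M[R]_n :=
  \matrix_(x, y) \sum_t u 0 t * (osign R x y * incidence R (enum_val t) [set x; y]).

Lemma edgevalC (R : comNzRingType) (n : nat) (E : {set {set 'I_n}})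
    (u : 'rV[R]_#|triangles E|) (x y : 'I_n) :
  edgeval u y x = - edgeval u x y.
Proof.
rewrite !mxE -sumrN; apply: eq_bigr => t _.
by rewrite setUC osignC; ring.
Qed.

Lemma edgevalB (R : comNzRingType) (n : nat) (E : {set {set 'I_n}})
    (u v : 'rV[R]_#|triangles E|) (x y : 'I_n) :
  edgeval (u - v) x y = edgeval u x y - edgeval v x y.
Proof.
by rewrite !mxE -sumrB; apply: eq_bigr => t _; rewrite !mxE mulrBl.
Qed.

Lemma edgevalZ (R : comNzRingType) (n : nat) (E : {set {set 'I_n}}) (a : R)
    (u : 'rV[R]_#|triangles E|) (x y : 'I_n) :
  edgeval (a *: u) x y = a * edgeval u x y.
Proof.
by rewrite !mxE mulr_sumr; apply: eq_bigr => t _; rewrite mxE mulrA.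
Qed.

Lemma edgeval_nonedge (R : comNzRingType) (n : nat) (E : {set {set 'I_n}})
    (u : 'rV[R]_#|triangles E|) (x y : 'I_n) :
  [set x; y] \notin E -> edgeval u x y = 0.
Proof.
move=> xyE; rewrite mxE; apply: big1 => t _.
have [a [b [c [ab bc tE]]]] := triangle_sorted (enum_valP t).
have := enum_valP t; rewrite tE set3_triangle => /and5P[_ _ _ Eab /andP[Ebc Eac]].
rewrite incidence_sorted //.
do 3![case: eqP => [e|_]; first by rewrite e ?Eab ?Ebc ?Eac in xyE].
by rewrite /= !mulr0n addr0 subr0 !mulr0.
Qed.

(* [edgeval u] is the boundary of the 2-chain [u], hence a cycle. *)
Lemma sum_edgeval (R : comNzRingType) (n : nat) (E : {set {set 'I_n}})
    (u : 'rV[R]_#|triangles E|) (x : 'I_n) : \sum_y edgeval u x y = 0.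
Proof.
under eq_bigr do rewrite mxE; rewrite exchange_big big1 // => t _; rewrite -mulr_sumr.
have [a [b [c [ab bc tE]]]] := triangle_sorted (enum_valP t).
rewrite tE; under eq_bigr do rewrite osign_incidence //.
by rewrite 2!big_split /= !sum_oedge; ring.
Qed.

(** * The Laplacian in terms of edge functions *)

(** The second factor [(coboundary1 R E)^T] takes the coboundary of the edge function of [u];
    antisymmetry puts it in cyclic form. *)
Lemma mul_down_laplacian2 (R : comNzRingType) (n : nat) (E : {set {set 'I_n}})
    (u : 'rV[R]_#|triangles E|) (t : 'I_#|triangles E|) (a b c : 'I_n) :
    (a < b)%N -> (b < c)%N -> enum_val t = [set a; b; c] ->
  (u *m down_laplacian2 R E) 0 t =
    edgeval u a b + edgeval u b c + edgeval u c a.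
Proof.
move=> ab bc tE; have ac := ltn_trans ab bc.
have := enum_valP t; rewrite tE set3_triangle => /and5P[_ _ _ Eab /andP[Ebc Eac]].
(* [F] is the row [u *m coboundary1 R E] read on unordered edges; it agrees with [edgeval u] on
   increasing pairs. *)
pose F (e : {set 'I_n}) : R := \sum_s u 0 s * incidence R (enum_val s) e.
have FE (x y : 'I_n) : (x < y)%N -> F [set x; y] = edgeval u x y.
  move=> xy; rewrite mxE; apply: eq_bigr => s _.
  by rewrite /osign xy ltnNge ltnW //= subr0 mul1r.
rewrite /down_laplacian2 mulmxA mxE.
transitivity (\sum_(e in E) F e * incidence R [set a; b; c] e).
  rewrite [RHS]big_enum_val; apply: eq_bigr => e _; rewrite !mxE -tE; congr (_ * _).
  by apply: eq_bigr => s _; rewrite mxE.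
have S (x y : 'I_n) : [set x; y] \in E ->
    \sum_(e in E) F e * (e == [set x; y])%:R = F [set x; y].
  move=> xyE; rewrite (bigD1 [set x; y]) //= eqxx mulr1 big1 ?addr0 // => e.
  by case/andP=> _ /negPf->; rewrite mulr0.
under eq_bigr do rewrite incidence_sorted // mulrBr mulrDr.
by rewrite sumrB big_split /= !S // !FE // (edgevalC u a c).
Qed.

Lemma sum_third (R : comNzRingType) (n : nat) (x y w : 'I_n) (G : 'I_n -> R) :
    x != y -> y != w -> x != w ->
  \sum_z ([set x; y; w] == [set x; y; z])%:R * G z = G w.
Proof.
move=> xy yw xw; rewrite (bigD1 w) //= eqxx mul1r big1 ?addr0 // => z zw.
case: eqP => [/setP/(_ w)|_]; last by rewrite mul0r.
by rewrite !inE eqxx orbT (eq_sym w x) (negPf xw) (eq_sym w y) (negPf yw)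
  (eq_sym w z) (negPf zw).
Qed.

(** Both sides vanish unless [x] and [y] are distinct vertices of the triangle. Otherwise [z] must
    be the third vertex, and the cyclic sum of [f] changes by the sign of the permutation taking
    [a], [b], [c] to [x], [y], [z]. *)
Lemma incidence_third (R : comNzRingType) (n : nat) (f : 'I_n -> 'I_n -> R)
    (a b c x y : 'I_n) : (forall x y, f y x = - f x y) ->
    (a < b)%N -> (b < c)%N ->
  (f a b + f b c + f c a) * (osign R x y * incidence R [set a; b; c] [set x; y])
  = \sum_z ([set a; b; c] == [set x; y; z])%:R * (f x y + f y z + f z x).
Proof.
move=> fC ab bc; have ac := ltn_trans ab bc.
have ff0 p : f p p + f p p = 0 by rewrite {1}fC addNr.
have sum0 : ~~ [&& x != y, x \in [set a; b; c] & y \in [set a; b; c]] ->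
    \sum_z ([set a; b; c] == [set x; y; z])%:R * (f x y + f y z + f z x) = 0.
  move=> nT; apply: big1 => z _; case: eqP => [e|_]; last by rewrite mul0r.
  have : #|[set x; y; z]| == 3.
    by rewrite -e cards3 (ord_lt_eqF ab) (ord_lt_eqF bc) (ord_lt_eqF ac).
  by move: nT; rewrite cards3 e !inE !eqxx orbT /= andbT => /negPf ->.
rewrite osign_incidence // /oedge.
have [xT|] := boolP (x \in [set a; b; c]); last first.
  move=> xT; rewrite sum0 ?(negPf xT) ?andbF //; move: xT.
  by rewrite !inE !negb_or -andbA => /and3P[/negPf-> /negPf-> /negPf->] /=; ring.
have [yT|] := boolP (y \in [set a; b; c]); last first.
  move=> yT; rewrite sum0 ?(negPf yT) ?andbF //; move: yT.
  by rewrite !inE !negb_or -andbA => /and3P[/negPf-> /negPf-> /negPf->];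
     rewrite !andbF /=; ring.
move: sum0; move: xT yT; rewrite !inE.
(* Nine positions of [x] and [y] among [a], [b], [c]: three are degenerate, three cyclic, and three
   odd, where all values of [f] are flipped. *)
case/orP => [/orP[]|] /eqP->; case/orP => [/orP[]|] /eqP->;
  rewrite !eqxx ?(ord_lt_eqF ab) ?(ord_lt_eqF bc) ?(ord_lt_eqF ac) /= => sum0.
- by rewrite sum0 //; ring.
- by rewrite sum_third ?(ord_lt_eqF ab) ?(ord_lt_eqF bc)
    ?(ord_lt_eqF ac) //; ring.
- rewrite set3C set3CA sum_third ?(ord_lt_eqF ab) ?(ord_lt_eqF bc)
    ?(ord_lt_eqF ac) //.
  by rewrite (fC c a) (fC b c) (fC a b); ring.
- rewrite set3C sum_third ?(ord_lt_eqF ab) ?(ord_lt_eqF bc)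
    ?(ord_lt_eqF ac) //.
  by rewrite (fC a b) (fC c a) (fC b c); ring.
- by rewrite sum0 //; ring.
- by rewrite set3CA sum_third ?(ord_lt_eqF ab) ?(ord_lt_eqF bc)
    ?(ord_lt_eqF ac) //; ring.
- by rewrite -set3CA sum_third ?(ord_lt_eqF ab) ?(ord_lt_eqF bc)
    ?(ord_lt_eqF ac) //; ring.
- rewrite set3C -set3CA sum_third ?(ord_lt_eqF ab) ?(ord_lt_eqF bc)
    ?(ord_lt_eqF ac) //.
  by rewrite (fC b c) (fC a b) (fC c a); ring.
- by rewrite sum0 //; ring.
Qed.

(** With [d] for [coboundary1 R E], the edge function of [u *m d *m d^T] is that of [u] acted on by
    the up Laplacian [d^T *m d] on edges, which sums over the triangles containing an edge. *)
Lemma edgeval_laplacian (R : comNzRingType) (n : nat) (E : {set {set 'I_n}})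
    (u : 'rV[R]_#|triangles E|) (x y : 'I_n) :
  edgeval (u *m down_laplacian2 R E) x y =
    \sum_z ([set x; y; z] \in triangles E)%:R *
      (edgeval u x y + edgeval u y z + edgeval u z x).
Proof.
rewrite [LHS]mxE.
transitivity (\sum_(T in triangles E) \sum_z (T == [set x; y; z])%:R *
      (edgeval u x y + edgeval u y z + edgeval u z x)).
  rewrite [RHS]big_enum_val; apply: eq_bigr => t _.
  have [a [b [c [ab bc tE]]]] := triangle_sorted (enum_valP t).
  rewrite (mul_down_laplacian2 u ab bc tE) tE incidence_third //.
  exact: edgevalC.
rewrite exchange_big; apply: eq_bigr => z _ /=; rewrite -mulr_suml; congr (_ * _).
case: (boolP (_ \in _)) => zT; last first.
  by apply: big1 => T TT; case: eqP => // e; rewrite -e TT in zT.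
rewrite (bigD1 [set x; y; z]) //= eqxx big1 ?addr0 // => T /andP[_ /negPf->] //.
Qed.

(** Each diagonal entry is 3: the edge function of a single triangle is 1 on each of its three
    cyclically oriented edges. *)
Lemma trace_down_laplacian2 (R : comNzRingType) (n : nat)
    (E : {set {set 'I_n}}) :
  \tr (down_laplacian2 R E) = (3 * #|triangles E|)%:R.
Proof.
rewrite natrM mulr_natr -[X in _ *+ X]card_ord -sumr_const; apply: eq_bigr => t _.
have [a [b [c [ab bc tE]]]] := triangle_sorted (enum_valP t).
have -> : down_laplacian2 R E t t =
    ((delta_mx 0 t : 'rV_#|triangles E|) *m down_laplacian2 R E) 0 t.
  by rewrite -rowE [RHS]mxE.
rewrite (mul_down_laplacian2 _ ab bc tE).
have S x y : edgeval (delta_mx 0 t : 'rV[R]_#|triangles E|) x y =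
    osign R x y * incidence R [set a; b; c] [set x; y].
  rewrite mxE (bigD1 t) //= !mxE !eqxx mul1r big1 ?addr0 ?tE // => s /negPf st.
  by rewrite mxE st andbF mul0r.
have ac := ltn_trans ab bc.
rewrite !S !osign_incidence // /oedge !eqxx.
rewrite !(ord_lt_eqF ab) !(ord_lt_eqF bc) !(ord_lt_eqF ac) /=.
by rewrite !mulr0n !mulr1n; ring.
Qed.

Lemma down_laplacian2_eq0 (R : comNzRingType) (n : nat) (E : {set {set 'I_n}})
    (u : 'rV[R]_#|triangles E|) :
  (forall x y, edgeval u x y = 0) -> u *m down_laplacian2 R E = 0.
Proof.
move=> u0; apply/rowP => t; rewrite [RHS]mxE.
have [a [b [c [ab bc tE]]]] := triangle_sorted (enum_valP t).
by rewrite (mul_down_laplacian2 u ab bc tE) !u0 !addr0.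
Qed.

(** Up to orientation signs, [K] restricts the edge function of a chain to [D]; the hypothesis makes
    this restriction injective on the row space of [V]. *)
Lemma rank_le_edges (F : fieldType) (n m : nat) (E D : {set {set 'I_n}})
    (V : 'M[F]_(m, #|triangles E|)) :
    (forall u : 'rV_#|triangles E|, (u <= V)%MS ->
      (forall x y, [set x; y] \in D -> edgeval u x y = 0) -> u = 0) ->
  (\rank V <= #|D|)%N.
Proof.
move=> inj; pose K : 'M[F]_(#|triangles E|, #|D|) :=
  \matrix_(t, k) incidence F (enum_val t) (enum_val k).
apply: (@rank_le_injective _ _ _ _ _ K) => u uV uK; apply: inj => // x y xyD.
have /rowP/(_ (enum_rank_in xyD [set x; y])) := uK; rewrite !mxE => uK0.
under eq_bigr do rewrite mulrCA.
rewrite -mulr_sumr.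
transitivity (osign F x y * 0); last by rewrite mulr0.
congr (_ * _); rewrite -[RHS]uK0; apply: eq_bigr => t _.
by rewrite mxE enum_rankK_in.
Qed.

(** * Complete split graphs *)

Definition complete_split (n : nat) (C : {set 'I_n}) (E : {set {set 'I_n}}) :=
  forall x y, ([set x; y] \in E) = (x != y) && ((x \in C) || (y \in C)).

Lemma edgeval_refl (R : comNzRingType) (n : nat) (E : {set {set 'I_n}})
    (u : 'rV[R]_#|triangles E|) (x : 'I_n) : edgeval u x x = 0.
Proof. by rewrite mxE; apply: big1 => t _; rewrite /osign subrr mul0r mulr0. Qed.

Lemma edgeval_independent (R : comNzRingType) (n : nat) (C : {set 'I_n})
    (E : {set {set 'I_n}}) (u : 'rV[R]_#|triangles E|) (x y : 'I_n) :
    complete_split C E -> x \notin C -> y \notin C ->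
  edgeval u x y = 0.
Proof.
move=> EC /negPf xC /negPf yC.
by apply: edgeval_nonedge; rewrite EC xC yC andbF.
Qed.

(** Every further vertex [z] completes an edge of the clique to a triangle, and the terms at [z = x]
    and [z = y] cancel. Summing over all [z] leaves [n] copies of the value and two vanishing vertex
    sums. *)
Lemma edgeval_clique (R : comNzRingType) (n : nat) (C : {set 'I_n})
    (E : {set {set 'I_n}}) (u : 'rV[R]_#|triangles E|) (x y : 'I_n) :
    complete_split C E -> x \in C -> y \in C ->
  edgeval (u *m down_laplacian2 R E) x y = n%:R * edgeval u x y.
Proof.
move=> EC xC yC; have [->|xy] := eqVneq x y; first by rewrite !edgeval_refl mulr0.
rewrite edgeval_laplacian.
transitivity (\sum_z (edgeval u x y + edgeval u y z + edgeval u z x)).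
  apply: eq_bigr => z _; rewrite set3_triangle !EC xC yC xy /= ?orbT ?andbT.
  have [<-|yz] := eqVneq y z.
    by rewrite mul0r edgeval_refl addr0 (edgevalC u x y) subrr.
  have [<-|xz] := eqVneq x z; last by rewrite mul1r.
  by rewrite mul0r edgeval_refl addr0 (edgevalC u x y) subrr.
rewrite !big_split /= sum_edgeval sumr_const card_ord addr0.
under [X in _ + X]eq_bigr do rewrite edgevalC.
by rewrite sumrN sum_edgeval oppr0 addr0 mulr_natl.
Qed.

(** The third vertex must lie in [C]. The sum of [edgeval u y z] over [C] is the whole vertex sum at
    [y], hence 0; the vertex sum at [x] moves the remaining sum to the complement of [C]. *)
Lemma edgeval_cross (R : comNzRingType) (n : nat) (C : {set 'I_n})
    (E : {set {set 'I_n}}) (u : 'rV[R]_#|triangles E|) (x y : 'I_n) :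
    complete_split C E -> x \in C -> y \notin C ->
  edgeval (u *m down_laplacian2 R E) x y =
    #|C|%:R * edgeval u x y + \sum_(q in ~: C) edgeval u x q.
Proof.
move=> EC xC yC.
have yC' z : z \in C -> y != z by apply: contraTneq => <-.
rewrite edgeval_laplacian.
transitivity (\sum_(z in C) (edgeval u x y + edgeval u y z + edgeval u z x)).
  rewrite [RHS]big_mkcond; apply: eq_bigr => z _.
  rewrite set3_triangle !EC xC (negPf yC) (eq_sym x y) yC' //= !andbT.
  have [zC|] := boolP (z \in C); last by rewrite !andbF mul0r.
  rewrite yC' //; have [<-|xz] := eqVneq x z; last by rewrite mul1r.
  by rewrite mul0r edgeval_refl addr0 (edgevalC u x y) subrr.
rewrite !big_split /= sumr_const mulr_natl -addrA; congr (_ + _).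
have := sum_edgeval u y; rewrite (bigID (mem C)) /=.
rewrite [X in _ + X]big1 ?addr0 => [->|z zC]; last first.
  exact: edgeval_independent EC yC zC.
have := sum_edgeval u x; rewrite (bigID (mem C)) /= => /eqP.
rewrite addrC addr_eq0 add0r => /eqP uE.
under eq_bigr do rewrite edgevalC.
by rewrite sumrN -uE; apply: eq_bigl => z; rewrite in_setC.
Qed.

Lemma edgeval_eq0 (R : comNzRingType) (n : nat) (C : {set 'I_n})
    (E : {set {set 'I_n}}) (u : 'rV[R]_#|triangles E|) :
    complete_split C E -> {in C &, forall x y, edgeval u x y = 0} ->
    (forall x y, x \in C -> y \notin C -> edgeval u x y = 0) ->
  forall x y, edgeval u x y = 0.
Proof.
move=> EC u_clique u_cross x y.
have [xC|xC] := boolP (x \in C); have [yC|yC] := boolP (y \in C).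
- exact: u_clique.
- exact: u_cross.
- by rewrite edgevalC u_cross ?oppr0.
- exact: edgeval_independent EC xC yC.
Qed.

(** After the factor at [#|C|], the value on a cross edge from [x] in [C] no longer depends on its
    outer end, so the Laplacian multiplies it by [#|C| + #|~: C| = n]. The factor at [n] thus kills
    the edge function on cross edges as well as inside [C], and the last factor kills the chain. *)
Lemma down_laplacian2_annihilator (R : comNzRingType) (n : nat) (C : {set 'I_n})
    (E : {set {set 'I_n}}) : complete_split C E ->
  \prod_(a <- [:: #|C|%:R; n%:R; 0]) (down_laplacian2 R E - a%:M) = 0.
Proof.
move=> EC; have nE : n%:R = #|C|%:R + #|~: C|%:R :> R.
  by rewrite -natrD cardsC card_ord.
set L := down_laplacian2 _ _; rewrite !big_cons big_nil mulr1 raddf0 subr0.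
rewrite -!mulmxE; apply/row_matrixP => t; rewrite row0 rowE mulmxA.
set u := delta_mx 0 t : 'rV[R]_#|triangles E|.
rewrite mulmxA !mulmxBr !mul_mx_scalar.
set v := u *m L - _; apply: down_laplacian2_eq0.
have v_cross x y : x \in C -> y \notin C ->
    edgeval v x y = \sum_(q in ~: C) edgeval u x q.
  by move=> xC yC; rewrite edgevalB edgevalZ (edgeval_cross _ EC) //; ring.
apply: (edgeval_eq0 EC) => x y xC yC; rewrite edgevalB edgevalZ.
  by rewrite (edgeval_clique _ EC) // subrr.
rewrite (edgeval_cross _ EC) // v_cross //.
have -> : \sum_(q in ~: C) edgeval v x q =
    #|~: C|%:R * \sum_(q in ~: C) edgeval u x q.
  rewrite mulr_natl -sumr_const; apply: eq_bigr => q.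
  by rewrite in_setC; exact: v_cross.
by rewrite nE; ring.
Qed.

(** * Eigenspace bounds and the number of triangles *)

(** If the edge function of an eigenvector vanishes inside [C], the vertex sum at [x] in [C] reduces
    to the cross edges. The cross formula then multiplies these values by [#|C|], which differs from
    [n], so they vanish too. *)
Lemma rank_eigenspace_clique (R : numFieldType) (n : nat) (C : {set 'I_n})
    (E : {set {set 'I_n}}) : complete_split C E -> (0 < #|~: C|)%N ->
  (\rank (eigenspace (down_laplacian2 R E) n%:R) <= 'C(#|C|, 2))%N.
Proof.
move=> EC b_gt0; have nE : n%:R = #|C|%:R + #|~: C|%:R :> R.
  by rewrite -natrD cardsC card_ord.
rewrite -cards_draws; apply: rank_le_edges => u /eigenspaceP uL u0.
have u_clique : {in C &, forall x y, edgeval u x y = 0}.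
  move=> x y xC yC; have [->|xy] := eqVneq x y; first exact: edgeval_refl.
  apply: u0; rewrite inE cards2 xy eqxx andbT.
  by apply/subsetP => z; rewrite !inE => /orP[] /eqP ->.
have {}u0 : forall x y, edgeval u x y = 0.
  apply: (edgeval_eq0 EC) => // x y xC yC.
  have := edgevalZ n%:R u x y; rewrite -uL (edgeval_cross _ EC) //.
  have := sum_edgeval u x; rewrite (bigID (mem C)) /=.
  rewrite big1 => [|z zC]; last exact: u_clique.
  rewrite add0r (eq_bigl (mem (~: C))) => [->|z]; last by rewrite /= in_setC.
  move/esym/eqP; rewrite addr0 -subr_eq0 -mulrBl nE addrC addKr.
  by rewrite mulf_eq0 pnatr_eq0 gtn_eqF //= => /eqP.
have /esym/eqP := down_laplacian2_eq0 u0; rewrite uL eq_sym scaler_eq0.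
by rewrite nE -natrD pnatr_eq0 addn_eq0 andbC gtn_eqF //= => /eqP.
Qed.

Lemma rank_eigenspace_cross (R : numFieldType) (n : nat) (C : {set 'I_n})
    (E : {set {set 'I_n}}) :
    complete_split C E -> (0 < #|C|)%N -> (0 < #|~: C|)%N ->
  (\rank (eigenspace (down_laplacian2 R E) #|C|%:R)
     <= (#|~: C| - 1) * (#|C| - 1))%N.
Proof.
move=> EC c_gt0 b_gt0; have nE : n%:R = #|C|%:R + #|~: C|%:R :> R.
  by rewrite -natrD cardsC card_ord.
have [x0 x0C] := card_gt0P c_gt0; have [y0 y0C'] := card_gt0P b_gt0.
have y0C : y0 \notin C by rewrite -in_setC.
(* Omitting the row of [x0] and the column of [y0] loses nothing for a matrix with zero row and
   column sums. *)
pose D := [set [set p.1; p.2] | p in setX (C :\ x0) (~: C :\ y0)].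
have D_le : (#|D| <= (#|~: C| - 1) * (#|C| - 1))%N.
  apply: leq_trans (leq_imset_card _ _) _; rewrite cardsX mulnC.
  by rewrite (cardsD1 y0 (~: C)) y0C' (cardsD1 x0 C) x0C !addKn.
apply: leq_trans D_le; apply: rank_le_edges => u /eigenspaceP uL u0.
have u_clique : {in C &, forall x y, edgeval u x y = 0}.
  move=> x y xC yC; have := edgevalZ #|C|%:R u x y.
  rewrite -uL (edgeval_clique _ EC) // => /eqP.
  rewrite -subr_eq0 -mulrBl nE addrC addKr.
  by rewrite mulf_eq0 pnatr_eq0 gtn_eqF //= => /eqP.
(* Zero row sums come from the eigenvalue equation at [y0]; zero column sums come from the vertex
   sum at [y], as the values inside the independent set vanish. *)
have u_row x : x \in C -> \sum_(q in ~: C) edgeval u x q = 0.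
  move=> xC; have := edgevalZ #|C|%:R u x y0; rewrite -uL (edgeval_cross _ EC) //.
  by move/eqP; rewrite -subr_eq0 addrC addKr => /eqP.
have u_D x y : x \in C -> y \notin C -> x != x0 -> y != y0 -> edgeval u x y = 0.
  move=> xC yC xx0 yy0; apply: u0; apply/imsetP; exists (x, y) => //.
  by rewrite !inE xx0 yy0 xC yC.
have u_y0 x : x \in C -> x != x0 -> edgeval u x y0 = 0.
  move=> xC xx0; have := u_row x xC; rewrite (bigD1 y0) //=.
  rewrite big1 ?addr0 // => y; rewrite in_setC => /andP[yC yy0].
  exact: u_D.
have u_x0 y : y \notin C -> edgeval u x0 y = 0.
  move=> yC; have := sum_edgeval u y; rewrite (bigD1 x0) //= big1 => [|x xx0].
    by rewrite addr0 edgevalC => /eqP; rewrite oppr_eq0 => /eqP.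
  have [xC|xC] := boolP (x \in C); last exact: edgeval_independent EC yC xC.
  rewrite edgevalC; have [->|yy0] := eqVneq y y0; first by rewrite u_y0 ?oppr0.
  by rewrite u_D ?oppr0.
have {}u0 : forall x y, edgeval u x y = 0.
  apply: (edgeval_eq0 EC) => // x y xC yC.
  have [->|xx0] := eqVneq x x0; first exact: u_x0.
  by have [->|yy0] := eqVneq y y0; [exact: u_y0 | exact: u_D].
have /esym/eqP := down_laplacian2_eq0 u0; rewrite uL eq_sym scaler_eq0.
by rewrite pnatr_eq0 gtn_eqF //= => /eqP.
Qed.

(** Vertices outside [C] are pairwise nonadjacent, so a triangle lies in [C] or consists of one
    outer vertex and a pair in [C]. *)
Lemma card_triangles_split (n : nat) (C : {set 'I_n}) (E : {set {set 'I_n}}) :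
    complete_split C E ->
  #|triangles E| = ('C(#|C|, 3) + #|~: C| * 'C(#|C|, 2))%N.
Proof.
move=> EC; rewrite -(cardsID (powerset C)); congr (_ + _)%N.
  rewrite -cards_draws; apply: eq_card => T.
  rewrite !inE; have [TC|] := boolP (T \subset C); rewrite ?andbF ?andbT //=.
  rewrite -[RHS]andbT; congr (_ && _); apply/forall_inP => i iT.
  apply/forall_inP => j jT; apply/implyP => ij.
  by rewrite EC ij (subsetP TC i iT).
rewrite -cards_draws -cardsX.
(* The map adding an outer vertex [p] to a pair [A] is injective, since [p] is the only element of
   the result outside [C]. *)
set D := setX _ _; rewrite -(@card_in_imset _ _ (fun p => p.1 |: p.2) D).
  apply: eq_card => T; apply/idP/imsetP => [|[[p A] pA ->]].
    rewrite !inE => /andP[TC /andP[T3 /forall_inP TE]].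
    have [p pT pC] := subsetPn TC.
    exists (p, T :\ p); last by rewrite setD1K.
    rewrite !inE pC /=; move: T3; rewrite (cardsD1 p) pT add1n eqSS => ->.
    rewrite andbT; apply/subsetP => q; rewrite !inE => /andP[qp qT].
    have /forall_inP/(_ q qT) := TE p pT.
    by rewrite (eq_sym p) qp EC (negPf pC) => /andP[].
  move: pA; rewrite !inE /= => /andP[pC /andP[AC /cards2P[x [y [xy AE]]]]].
  have [xA yA] : x \in A /\ y \in A by rewrite AE !inE !eqxx orbT.
  have [xC yC] := (subsetP AC x xA, subsetP AC y yA).
  have neq z : z \in C -> p != z by apply: contraTneq => <-.
  apply/andP; split.
    by apply: contra pC => /subsetP; apply; rewrite !inE eqxx.
  have := set3_triangle E p x y; rewrite !EC xy !neq // xC yC orbT /=.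
  by rewrite inE AE setUA => ->.
move=> [p A] [q B]; rewrite !inE /=.
move=> /andP[pC /andP[AC _]] /andP[qC /andP[BC _]] pAqB.
have AE : A = B.
  apply/setP => z; have /setP/(_ z) := pAqB; rewrite !inE.
  have [zC|zC] := boolP (z \in C); last first.
    by rewrite (contraNF (subsetP AC z) zC) (contraNF (subsetP BC z) zC).
  have neq t : t \notin C -> z == t = false.
    by apply: contraNF => /eqP <-.
  by rewrite !neq.
have /setP/(_ p) := pAqB; rewrite !inE eqxx /=.
by rewrite (contraNF (subsetP BC p) pC) orbF => /esym/eqP ->; rewrite AE.
Qed.

(** * The graph [Gedges c b] and its multiplicities *)

Lemma Gedges_complete_split (c b : nat) :
  complete_split [set x : 'I_(b + c) | (x < c)%N] (Gedges c b).
Proof.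
move=> x y; rewrite !inE; apply/existsP/andP => [[i /existsP[j]]|].
  move=> /andP[/eqP/setP E ij].
  move: (E x) (E y) (E i) (E j); rewrite !inE !eqxx ?orbT /= -!val_eqE /=.
  by move=> *; split; lia.
rewrite -val_eqE /=; case: (ltngtP x y) => [xy|xy|_] [] // _ xyc.
  have [yc|yc] := ltnP y c.
    by exists x; apply/existsP; exists y; rewrite eqxx xy yc.
  exists y; apply/existsP; exists x; rewrite setUC eqxx yc /=.
  by apply/orP; right; lia.
have [xc|xc] := ltnP x c.
  by exists y; apply/existsP; exists x; rewrite setUC eqxx xy xc.
by exists x; apply/existsP; exists y; rewrite eqxx xc /=; apply/orP; right; lia.
Qed.

Lemma card_ord_lt (c b : nat) : #|[set x : 'I_(b + c) | (x < c)%N]| = c.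
Proof.
rewrite -sum1_card; under eq_bigl do rewrite inE.
by rewrite (big_ord_narrow (leq_addl b c)) sum1_card card_ord.
Qed.

Lemma perm_three_values (T : eqType) (s : seq T) (x y z : T) :
    x != y -> x != z -> y != z -> {subset s <= [:: x; y; z]} ->
  perm_eq s (nseq (count_mem x s) x ++ nseq (count_mem y s) y
             ++ nseq (count_mem z s) z).
Proof.
move=> xy xz yz sub; apply/allP => a; rewrite mem_cat => a_in.
have {a_in} : a \in [:: x; y; z].
  case/orP: a_in => [/sub //|]; rewrite !mem_cat !mem_nseq !inE.
  by case/or3P => /andP[_ ->]; rewrite ?orbT.
rewrite !inE /= !count_cat !count_nseq /= => /or3P[] /eqP->; rewrite !eqxx.
- by rewrite (eq_sym y) (eq_sym z) (negPf xy) (negPf xz) !mul0n mul1n !addn0.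
- by rewrite (eq_sym z) (negPf xy) (negPf yz) !mul0n mul1n addn0.
- by rewrite (negPf xz) (negPf yz) !mul0n mul1n.
Qed.

(** The two upper bounds themselves satisfy the trace equation. Its weights [c] and [b + c] are
    positive, so neither inequality can be strict. *)
Lemma split_multiplicities (c b m1 m2 : nat) : (0 < c)%N -> (0 < b)%N ->
    (m1 <= (b - 1) * (c - 1))%N -> (m2 <= 'C(c, 2))%N ->
    (m1 * c + m2 * (b + c) = 3 * ('C(c, 3) + b * 'C(c, 2)))%N ->
  m1 = ((b - 1) * (c - 1))%N /\ m2 = 'C(c, 2).
Proof.
case: c => // c; case: b => // b _ _ m1_le m2_le mE.
have b3 := mul_bin_diag c.+1 2; have b2 := mul_bin_diag c.+1 1.
have b1 := binS c 1; rewrite bin1 /= in b1 b2 b3.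
rewrite !subn1 /= in m1_le *.
have m1_le' : (m1 * c.+1 <= b * c * c.+1)%N by rewrite leq_mul2r m1_le orbT.
have m2_le' : (m2 * (b.+1 + c.+1) <= 'C(c.+1, 2) * (b.+1 + c.+1))%N.
  by rewrite leq_mul2r m2_le orbT.
(* In the original [c], this rests on [2 * 'C(c, 2) = c * (c - 1)] and
   [3 * 'C(c, 3) = (c - 2) * 'C(c, 2)]. *)
have E : (b * c * c.+1 + 'C(c.+1, 2) * (b.+1 + c.+1) =
          3 * ('C(c.+1, 3) + b.+1 * 'C(c.+1, 2)))%N by nia.
split; apply/eqP.
  by rewrite -(eqn_pmul2r (ltn0Sn c)); lia.
by rewrite -(@eqn_pmul2r (b.+1 + c.+1)) //; lia.
Qed.

Unset Implicit Arguments.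

Theorem theorem3p19 (R : numFieldType) (c b : nat)
    (hc : (3 <= c)%N) (hb : (1 <= b)%N) :
  has_spectrum (down_laplacian2 R (Gedges c b))
    (nseq ('C(c, 3) + (b - 1) * 'C(c - 1, 2))%N 0
     ++ nseq ((b - 1) * (c - 1))%N c%:R
     ++ nseq 'C(c, 2) (b + c)%:R).
Proof.
have EC := @Gedges_complete_split c b; have cE := card_ord_lt c b.
have bE : #|~: [set x : 'I_(b + c) | (x < c)%N]| = b.
  by have := cardsC [set x : 'I_(b + c) | (x < c)%N]; rewrite cE card_ord; lia.
have c_gt0 : (0 < c)%N by lia.
have c_neq0 : 0 != c%:R :> R by rewrite eq_sym pnatr_eq0; lia.
have n_neq0 : 0 != (b + c)%:R :> R by rewrite eq_sym pnatr_eq0; lia.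
have c_neqn : c%:R != (b + c)%:R :> R by rewrite eqr_nat; lia.
have := down_laplacian2_annihilator R EC.
have := rank_eigenspace_clique R EC; have := rank_eigenspace_cross R EC.
have := card_triangles_split EC; have := trace_down_laplacian2 R (Gedges c b).
rewrite cE bE => trE TE m1_le m2_le /annihilated_has_spectrum[|s [spec]].
  by rewrite /= !inE !negb_or c_neqn (eq_sym _ 0) c_neq0 (eq_sym _ 0) n_neq0.
rewrite {}trE => trE sizeE s_sub; apply: (has_spectrum_perm _ spec).
have {}m1_le := m1_le c_gt0 hb; have {}m2_le := m2_le hb.
case: spec => _ countE; rewrite !countE in m1_le m2_le.
have {}s_sub : {subset s <= [:: 0; c%:R; (b + c)%:R]}.
  by move=> a /s_sub; rewrite !inE orbA orbC.
have s_perm := perm_three_values c_neq0 n_neq0 c_neqn s_sub.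
have /(split_multiplicities c_gt0 hb m1_le m2_le)[m1E m2E] :
    (count_mem c%:R s * c + count_mem (b + c)%:R s * (b + c) =
     3 * ('C(c, 3) + b * 'C(c, 2)))%N.
  (* The trace identity holds in [R]; characteristic 0 transfers it to natural numbers. *)
  apply/eqP; rewrite -(eqr_nat R) -TE trE (perm_big _ s_perm) /=.
  rewrite !big_cat /= !big_nseq !iter_addr_0 mul0rn add0r natrD !natrM.
  by rewrite !mulr_natl.
(* The multiplicity of 0 is what remains of the number of triangles, rewritten by
   ['C(c, 2) = 'C(c - 1, 2) + (c - 1)]. *)
have m0E : count_mem 0 s = ('C(c, 3) + (b - 1) * 'C(c - 1, 2))%N.
  have := perm_size s_perm; rewrite !size_cat !size_nseq sizeE TE m1E m2E.
  case: (c) c_gt0 => // k _; case: (b) hb => // d _.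
  rewrite (binS k 1) bin1 !subn1 /= => sE; apply/eqP.
  by rewrite -(eqn_add2r (d * k + ('C(k, 2) + k))) -sE; lia.
by rewrite m0E m1E m2E in s_perm.
Qed.
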